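(* Define $f$ on pairs of a non-negative integer $k$ and a positive integer $\omega$ by $f(0,\omega)=2$ and, for $k\ge 1$, $f(k,\omega)=\omega+(2+5k)\binom{\omega}{2}+f(k-1,\omega)\binom{\omega}{3}$. Then every finite graph $G$ with at least one vertex satisfies $\chi(G)\le f(\mathrm{iocp}(G),\omega(G))$.
   Context: The induced odd cycle packing number $\mathrm{iocp}(G)$ of a graph $G$ is the maximum integer $k$ such that $G$ contains an induced subgraph consisting of $k$ pairwise vertex-disjoint odd cycles (triangles count as odd cycles). $\chi(G)$ is the chromatic number and $\omega(G)$ the clique number of $G$. *)

(* Defs.v *)
From mathcomp Require Import all_boot.

Set Implicit Arguments.
Unset Strict Implicit.
Unset Printing Implicit Defensive.

Record sgraph := SGraph {
  svertex :> finType;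
  sedge : rel svertex;
  sedge_sym : symmetric sedge;
  sedge_irr : irreflexive sedge }.

Notation "x -- y" := (sedge x y) (at level 30, no associativity).

Section GraphParameters.

Variable G : sgraph.
Implicit Types (A C D : {set G}) (P : {set {set G}}) (k : nat).

Definition clique A :=
  [forall x in A, forall y in A, (x != y) ==> (x -- y)].

Definition omega := \max_(A : {set G} | clique A) #|A|.

Definition proper_coloring k (col : {ffun G -> 'I_k}) :=
  [forall x, forall y, (x -- y) ==> (col x != col y)].

Definition colorable k :=
  [exists col : {ffun G -> 'I_k}, proper_coloring col].

Lemma colorable_exists : exists k, colorable k.
Proof.
exists #|G|; apply/existsP; exists [ffun x => enum_rank x].
apply/forallP=> x; apply/forallP=> y; apply/implyP=> xy.
rewrite !ffunE (inj_eq enum_rank_inj).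
by apply: contraTneq xy => ->; rewrite sedge_irr.
Qed.

Definition chi := ex_minn colorable_exists.

(* The subgraph induced by C is a cycle of odd length: the vertices of C can
   be listed in a cyclic order c in which the edges of G between vertices of C
   are exactly the pairs that are consecutive in c.  The size bound keeps
   triangles and excludes a single vertex, which has odd size. *)
Definition induces_odd_cycle C :=
  [&& 2 < #|C|, odd #|C| &
      [exists c : #|C|.-tuple G,
         [&& uniq c, [set x in c] == C &
             [forall x in C, forall y in C,
                (x -- y) == ((y == next c x) || (x == next c y))]]]].

(* The subgraph induced by cover P is the vertex-disjoint union of #|P| odd
   cycles, whose vertex sets are the members of P; being induced, it has no
   edge of G between two different cycles. *)
Definition induced_odd_cycle_packing P :=
  [&& trivIset P,
      [forall C in P, induces_odd_cycle C] &
      [forall C in P, forall D in P, (C != D) ==>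
         [forall x in C, forall y in D, ~~ (x -- y)]]].

Definition iocp := \max_(P : {set {set G}} | induced_odd_cycle_packing P) #|P|.

End GraphParameters.

Fixpoint chi_bound (k w : nat) : nat :=
  if k is k'.+1 then
    w + (2 + 5 * k) * 'C(w, 2) + chi_bound k' w * 'C(w, 3)
  else 2.

(* Main.v *)
(* Fix a maximum clique K and sort the vertices by their set D of non-neighbours
   in K (a vertex of K being a non-neighbour of itself); D is never empty.
   Exchanging D for a clique of vertices with that same D cannot enlarge K, so
   the class of D is stable if #|D| = 1 and triangle-free if #|D| = 2.  If
   #|D| >= 3, the vertex is anticomplete to a triangle of K, and the vertices
   anticomplete to a given triangle induce a graph with smaller iocp.
   A triangle-free graph with iocp <= k is (2 + 5k)-colourable: if it is not
   bipartite, take a shortest odd closed walk.  It is an induced odd cycle, its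
   neighbourhood is 5-colourable, and the other vertices are anticomplete to it. *)
Require Import Defs.
From mathcomp Require Import all_boot.
From mathcomp Require Import zify.

Set Implicit Arguments.
Unset Strict Implicit.
Unset Printing Implicit Defensive.

(** * Walks of given length and shortest odd closed walks in a symmetric relation *)

Section Walks.

Variables (T : finType) (e : rel T).

Fixpoint walk n x y : bool :=
  if n is m.+1 then [exists z, e x z && walk m z y] else x == y.

Lemma walk_cat m n x y z : walk m x y -> walk n y z -> walk (m + n) x z.
Proof.
elim: m x => [|m IHm] x /=; first by move/eqP->.
case/existsP=> t /andP[xt ty] yz; apply/existsP; exists t.
by rewrite xt IHm.
Qed.

Lemma walk1 x y : e x y -> walk 1 x y.
Proof. by move=> xy; apply/existsP; exists y; rewrite xy /=. Qed.

Lemma walk_sym n x y : symmetric e -> walk n x y -> walk n y x.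
Proof.
move=> eC; elim: n x => [|n IHn] x; first by rewrite /= eq_sym.
case/existsP=> z /andP[xz zy]; rewrite -addn1.
by apply: walk_cat (IHn _ zy) _; apply: walk1; rewrite eC.
Qed.

Lemma connect_walk x y : connect e x y -> exists n, walk n x y.
Proof.
case/connectP=> p; elim: p x => [|z p IHp] x /=.
  by move=> _ ->; exists 0; rewrite /= eqxx.
case/andP=> xz zp /(IHp _ zp)[n zy]; exists n.+1.
by apply/existsP; exists z; rewrite xz.
Qed.

(** Indexing the vertices by [nat] turns subwalks and arcs into differences of indices; only the
    values of [c] at [0..n] matter. *)
Lemma walk_fun n x y : walk n x y ->
  exists c : nat -> T,
    [/\ c 0 = x, c n = y & forall i, i < n -> e (c i) (c i.+1)].
Proof.
elim: n x => [|n IHn] x /=; first by move/eqP->; exists (fun=> y).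
case/existsP=> z /andP[xz /IHn[c [c0 cn ce]]].
exists (fun i => if i is j.+1 then c j else x); split=> // -[|i] lt_in.
  by rewrite c0.
exact: ce.
Qed.

Lemma fun_walk (c : nat -> T) n i j :
  (forall k, k < n -> e (c k) (c k.+1)) -> i <= j <= n ->
  walk (j - i) (c i) (c j).
Proof.
move=> ce /andP[/subnKC <-]; rewrite addKn.
elim: (j - i) => [|d IHd] le_n; first by rewrite addn0 /= eqxx.
rewrite -[d.+1]addn1 addnA; apply: (walk_cat (IHd _)); first by lia.
by rewrite addn1; apply: walk1; apply: ce; lia.
Qed.

(** Colour each vertex by the parity of its distance from the root of its component. An edge whose
    ends get the same parity closes up, through the root, to a walk of odd length. *)
Lemma odd_closed_walk_or_2coloring : symmetric e ->
  (exists n x, odd n && walk n x x) \/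
  (exists c : T -> bool, forall x y, e x y -> c x != c y).
Proof.
move=> eC; have eS : connect_sym e by apply: sym_connect_sym.
have ex_dist x : exists n, walk n (root e x) x.
  by apply: connect_walk; rewrite eS connect_root.
pose dist x := ex_minn (ex_dist x).
have distP x : walk (dist x) (root e x) x by rewrite /dist; case: ex_minnP.
case: (boolP [forall x, forall y, e x y ==> (odd (dist x) != odd (dist y))]).
  move=> /forallP c_ok; right; exists (fun x => odd (dist x)) => x y xy.
  by have /forallP/(_ y)/implyP/(_ xy) := c_ok x.
case/forallPn=> x /forallPn[y]; rewrite negb_imply negbK => /andP[xy /eqP eq_d].
left; exists (dist x + (1 + dist y)), (root e x).
rewrite !oddD eq_d addbCA addbb /=.
have root_xy : root e x = root e y by apply/eqP; rewrite root_connect ?connect1.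
apply: walk_cat (distP x) (walk_cat (walk1 xy) _).
by apply: walk_sym => //; rewrite root_xy.
Qed.

(** Minimality is over closed walks, which may repeat vertices, so a competitor can be glued from
    arbitrary pieces and only its length and parity have to be checked. *)
Definition shortest_odd_cycle n (c : nat -> T) :=
  [/\ odd n, c n = c 0, forall i, i < n -> e (c i) (c i.+1) &
      forall m x, odd m -> walk m x x -> n <= m].

Lemma ex_shortest_odd_cycle : symmetric e ->
  (exists n c, shortest_odd_cycle n c) \/
  (exists c : T -> bool, forall x y, e x y -> c x != c y).
Proof.
move=> eC; case: (odd_closed_walk_or_2coloring eC); last by right.
case=> n0 [x0 /andP[odd_n0 wx0]]; left.
have ex_n : exists n, odd n && [exists x, walk n x x].
  by exists n0; rewrite odd_n0; apply/existsP; exists x0.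
case: (ex_minnP ex_n) => n /andP[odd_n /existsP[x wx]] min_n.
have [c [c0 cn ce]] := walk_fun wx.
exists n, c; split=> //; first by rewrite c0.
by move=> m y odd_m wy; apply: min_n; rewrite odd_m; apply/existsP; exists y.
Qed.

(* Close up the walk with either of the two arcs of the cycle; exactly one of
   the two closed walks so obtained is odd. *)
Lemma shortest_odd_cycle_dist n c l i j : symmetric e ->
  shortest_odd_cycle n c -> i <= j < n -> walk l (c i) (c j) ->
  if odd l == odd (j - i) then j - i <= l else n - (j - i) <= l.
Proof.
move=> eC [odd_n cn ce min_n] /andP[le_ij lt_jn] wl.
have wd : walk (j - i) (c i) (c j) by apply: fun_walk ce _; lia.
have wd' : walk (n - j + i) (c j) (c i).
  apply: (@walk_cat _ _ _ (c n)); first by apply: fun_walk ce _; lia.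
  by rewrite cn -{1}[i]subn0; apply: fun_walk ce _; lia.
case: eqP => par.
  have /(min_n _ (c i)) : odd (l + (n - j + i)) by lia.
  by move/(_ (walk_cat wl wd')); lia.
have /(min_n _ (c i)) : odd (l + (j - i)) by lia.
by move/(_ (walk_cat wl (walk_sym eC wd))); lia.
Qed.

End Walks.

(** * Colourings of vertex subsets *)

Section Coloring.

Variable G : sgraph.
Implicit Types (A B C D K Q T : {set G}) (P F : {set {set G}}) (k m n : nat).

(** Colours are naturals and [c] is total, so induced subgraphs are handled as sets and palettes can
    be shifted when colourings are combined. *)
Definition colorable_on A k := exists c : G -> nat,
  {in A, forall x, c x < k} /\ {in A &, forall x y, x -- y -> c x != c y}.

Lemma colorable_onW A B k m :
  A \subset B -> k <= m -> colorable_on B k -> colorable_on A m.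
Proof.
move=> /subsetP sAB le_km [c [ck cP]]; exists c; split=> [x /sAB /ck|x y xA yA].
  by move/leq_trans; apply.
by apply: cP; apply: sAB.
Qed.

Lemma colorable_onU A B k m :
  colorable_on A k -> colorable_on B m -> colorable_on (A :|: B) (k + m).
Proof.
move=> [c [ck cP]] [d [dm dP]].
exists (fun x => if x \in A then c x else k + d x); split.
  move=> x; rewrite inE; case: ifP => [xA _|_ /= xB].
    by have := ck _ xA; lia.
  by have := dm _ xB; lia.
move=> x y; rewrite !inE; case: ifP => [xA _|_ /= xB];
  case: ifP => [yA _|_ /= yB] xy.
- exact: cP.
- by have := ck _ xA; lia.
- by have := ck _ yA; lia.
- by have := dP _ _ xB yB xy; lia.
Qed.

(** The sets [S D] get disjoint palettes of [m] colours, and a vertex is coloured by the first set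
    containing it; hence the sets may overlap. *)
Lemma colorable_on_cover A F (S : {set G} -> {set G}) m :
  {in F, forall D, colorable_on (S D) m} ->
  {in A, forall x, exists2 D, D \in F & x \in S D} ->
  colorable_on A (m * #|F|).
Proof.
move=> colS covA; rewrite cardE mulnC.
have {}colS : {in enum F, forall D, colorable_on (S D) m}.
  by move=> D; rewrite mem_enum; apply: colS.
have {}covA : {in A, forall x, exists2 D, D \in enum F & x \in S D}.
  by move=> x /covA[D DF xD]; exists D; rewrite ?mem_enum.
elim: (enum F) A colS covA => [|D s IHs] A colS covA.
  by exists (fun=> 0); split=> [x /covA[]//|x y /covA[]].
apply: (@colorable_onW _ (S D :|: (A :\: S D)) (m + size s * m)) => //.
  by apply/subsetP=> x xA; rewrite !inE xA andbT orbN.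
apply: colorable_onU; first by apply: colS; rewrite mem_head.
apply: IHs => [E sE|x]; first by apply: colS; rewrite inE sE orbT.
rewrite inE => /andP[xD /covA[E]]; rewrite inE => /orP[/eqP-> xE|sE xE].
  by rewrite xE in xD.
by exists E.
Qed.

Lemma colorable_onT k : colorable_on setT k -> chi G <= k.
Proof.
move=> [c [ck cP]]; rewrite /chi; case: ex_minnP => m _; apply.
apply/existsP; exists [ffun x => Ordinal (ck x (in_setT x))].
apply/forallP=> x; apply/forallP=> y; apply/implyP=> xy.
by rewrite !ffunE -val_eqE /= cP.
Qed.

(** * Shortest odd closed walks of an induced subgraph are induced odd cycles *)

Definition edge_in A : rel G := fun x y => [&& x \in A, y \in A & x -- y].

Lemma edge_in_sym A : symmetric (edge_in A).
Proof. by move=> x y; rewrite /edge_in sedge_sym andbCA. Qed.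

(** Translates adjacency of indices into the [next] relation of a cyclic sequence; [c n = c 0] takes
    care of the wrap-around. *)
Lemma induces_odd_cycle_fun n (c : nat -> G) : odd n -> 2 < n -> c n = c 0 ->
  (forall i j, i < j < n -> c i != c j) ->
  (forall i j, i < j < n ->
     c i -- c j = (j == i.+1) || ((i == 0) && (j == n.-1))) ->
  induces_odd_cycle [set x in mkseq c n].
Proof.
move=> odd_n n_gt2 cn c_inj ce.
have c_inj' i j : i < n -> j < n -> (c i == c j) = (i == j).
  move=> lt_in lt_jn; case: (ltngtP i j) => [lt_ij|lt_ji|->].
  - by apply/negbTE/c_inj; rewrite lt_ij.
  - by rewrite eq_sym; apply/negbTE/c_inj; rewrite lt_ji.
  - exact: eqxx.
have Uc : uniq (mkseq c n).
  apply/(uniqP (c 0)) => i j; rewrite !inE size_mkseq => lt_in lt_jn.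
  by rewrite !nth_mkseq // => /eqP; rewrite c_inj' // => /eqP.
have sz : #|[set x in mkseq c n]| = n.
  by rewrite cardsE (card_uniqP Uc) size_mkseq.
have nextE i : i < n -> next (mkseq c n) (c i) = c i.+1.
  move=> lt_in; rewrite next_nth.
  have -> : c i \in mkseq c n by apply: map_f; rewrite mem_iota.
  have -> : index (c i) (mkseq c n) = i.
    by rewrite -(nth_mkseq (c 0) c lt_in) index_uniq ?size_mkseq.
  case: n n_gt2 cn Uc lt_in {odd_n c_inj ce c_inj' sz} => // n _ cn _ lt_in.
  rewrite /mkseq /= -[1]addn0 iotaDl -map_comp.
  (* At the last index [nth] runs off the tail and returns its default, the head [c 0]. *)
  move: lt_in; rewrite ltnS leq_eqVlt => /orP[/eqP->|lt_in].
    by rewrite nth_default ?size_map ?size_iota // cn.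
  by rewrite (nth_map 0) ?size_iota //= nth_iota // add0n add1n.
apply/and3P; split; rewrite ?sz //.
apply/existsP; exists (Tuple (introT eqP (size_mkseq c n))).
apply/and3P; split=> //.
have memP x : x \in [set x in mkseq c n] -> exists2 i, i < n & x = c i.
  by rewrite inE => /mapP[i]; rewrite mem_iota => ? ->; exists i.
have succ_eq i j : i < n -> j < n ->
    (c j == c i.+1) = (j == i.+1) || ((j == 0) && (i == n.-1)).
  move=> lt_in lt_jn; have [lt_i1n|] := ltnP i.+1 n.
    by rewrite c_inj' //; lia.
  by move=> le_ni; rewrite (_ : i.+1 = n) ?cn ?c_inj'; lia.
apply/forall_inP=> _ /memP[i lt_in ->]; apply/forall_inP=> _ /memP[j lt_jn ->].
rewrite /= !nextE // !succ_eq //; case: (ltngtP i j) => [lt_ij|lt_ji|<-].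
- by rewrite ce; lia.
- by rewrite sedge_sym ce; lia.
- by rewrite sedge_irr; lia.
Qed.

(** A repeated vertex is a walk of length 0 and a chord a walk of length 1 between two positions;
    the distance bound excludes the first and forces the ends of the second to be cyclically
    consecutive. *)
Lemma shortest_odd_cycle_induced A n c : shortest_odd_cycle (edge_in A) n c ->
  induces_odd_cycle [set x in mkseq c n].
Proof.
move=> cP; have [odd_n cn ce _] := cP.
have eC := @edge_in_sym A.
(* As [n] is odd, only [n = 1] has to be excluded, and it would give a loop. *)
have n_gt2 : 2 < n.
  case: n cP odd_n cn ce => [|[|[|n]]] // _ _ cn /(_ 0 isT).
  by rewrite cn /edge_in sedge_irr !andbF.
apply: induces_odd_cycle_fun => // i j ij.
  apply/eqP=> eq_c; have ij' : i <= j < n by lia.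
  have := @shortest_odd_cycle_dist _ _ n c 0 i j eC cP ij'.
  by rewrite /= eq_c eqxx => /(_ isT); case: ifP; lia.
apply/idP/idP=> [cij|].
  have ij' : i <= j < n by lia.
  have /walk1 : edge_in A (c i) (c j).
    have /and3P[iA _ _] : edge_in A (c i) (c i.+1) by apply: ce; lia.
    have /and3P[jA _ _] : edge_in A (c j) (c j.+1) by apply: ce; lia.
    by rewrite /edge_in iA jA.
  by move/(shortest_odd_cycle_dist eC cP ij'); case: ifP; lia.
case/orP=> [/eqP->|/andP[/eqP-> /eqP->]].
  by have /and3P[] : edge_in A (c i) (c i.+1) by apply: ce; lia.
have /and3P[_ _] : edge_in A (c n.-1) (c n.-1.+1) by apply: ce; lia.
by rewrite prednK ?cn 1?sedge_sym //; lia.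
Qed.

Lemma cycle_has_nbr A n c x : shortest_odd_cycle (edge_in A) n c ->
  x \in mkseq c n -> has (fun v => x -- v) (mkseq c n).
Proof.
case=> _ cn ce _ /mapP[i]; rewrite mem_iota => /= lt_in ->.
have /and3P[_ _ ei] := ce _ lt_in; apply/hasP; exists (c i.+1) => //.
have [lt_i1n|le_ni1] := ltnP i.+1 n; first by apply: map_f; rewrite mem_iota.
have -> : i.+1 = n by lia.
by rewrite cn; apply: map_f; rewrite mem_iota; lia.
Qed.

(** * Odd cycle packings inside a vertex set *)

Definition iocp_on_le A k := forall P,
  induced_odd_cycle_packing P -> cover P \subset A -> #|P| <= k.

Lemma iocp_on_leS A B k : B \subset A -> iocp_on_le A k -> iocp_on_le B k.
Proof. by move=> sBA le_k P packP sPB; apply: le_k; rewrite ?(subset_trans sPB). Qed.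

(** Adding [C] to a packing inside [B] gives a packing inside [A] with one more cycle. The empty
    packing already yields [0 < k]. *)
Lemma iocp_on_lt A B C k : C \subset A -> B \subset A -> induces_odd_cycle C ->
  {in C & B, forall x y, x != y /\ ~~ (x -- y)} ->
  iocp_on_le A k -> 0 < k /\ iocp_on_le B k.-1.
Proof.
move=> sCA sBA oddC anti le_k.
have step P : induced_odd_cycle_packing P -> cover P \subset B -> #|P|.+1 <= k.
  case/and3P=> trivP /forall_inP cycP /forall_inP antiP sPB.
  have disC D : D \in P -> [disjoint C & D].
    move=> DP; apply/pred0P=> x /=; apply/negP=> /andP[xC xD].
    have xB : x \in B by apply: (subsetP sPB); apply/bigcupP; exists D.
    by case: (anti x x xC xB); rewrite eqxx.
  have antiC x D y : x \in C -> D \in P -> y \in D -> ~~ (x -- y).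
    move=> xC DP yD; have yB : y \in B by apply: (subsetP sPB); apply/bigcupP; exists D.
    by case: (anti x y xC yB).
  have C0 : C != set0 by rewrite -card_gt0; case/and3P: oddC; lia.
  (* Members of [P] are disjoint from [C], and [C] is non-empty, hence not disjoint from itself. *)
  have CP : C \notin P.
    apply: contra C0 => /disC; rewrite -setI_eq0 setIid //.
  have <- : #|C |: P| = #|P|.+1 by rewrite cardsU1 CP.
  apply: le_k; last first.
    rewrite /cover; apply/bigcupsP=> D; rewrite !inE => /orP[/eqP->//|DP].
    apply: subset_trans (subset_trans sPB sBA); exact: bigcup_sup.
  apply/and3P; split.
  - apply/trivIsetP=> D E; rewrite !inE => /orP[/eqP->|DP] /orP[/eqP->|EP].
    + by rewrite eqxx.
    + by move=> _; apply: disC.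
    + by move=> _; rewrite disjoint_sym; apply: disC.
    + by move/trivIsetP: trivP; apply.
  - by apply/forall_inP=> D; rewrite !inE => /orP[/eqP->//|]; apply: cycP.
  apply/forall_inP=> D; rewrite !inE => D_in; apply/forall_inP=> E; rewrite !inE.
  move=> E_in; apply/implyP=> DE; apply/forall_inP=> x xD; apply/forall_inP=> y yE.
  case/orP: D_in => [/eqP DC|DP]; case/orP: E_in => [/eqP EC|EP].
  - by rewrite DC EC eqxx in DE.
  - by rewrite DC in xD; apply: antiC EP yE.
  - by rewrite EC in yE; rewrite sedge_sym; apply: antiC DP xD.
  have /forall_inP/(_ _ EP)/implyP/(_ DE) := antiP _ DP.
  by move/forall_inP/(_ _ xD)/forall_inP/(_ _ yE).
split; last by move=> P packP sPB; have := step P packP sPB; lia.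
have := step set0; rewrite cards0; apply.
  apply/and3P; split; first by apply/trivIsetP=> ?; rewrite inE.
  - by apply/forall_inP=> ?; rewrite inE.
  - by apply/forall_inP=> ?; rewrite inE.
by rewrite /cover big_set0 sub0set.
Qed.

Lemma shortest_odd_cycle_sub A n c : shortest_odd_cycle (edge_in A) n c ->
  [set x in mkseq c n] \subset A.
Proof.
case=> _ _ ce _; apply/subsetP=> x; rewrite inE => /mapP[i].
by rewrite mem_iota => /ce/and3P[iA _ _] ->.
Qed.

(** * Colouring triangle-free induced subgraphs *)

Lemma colorable2_or_odd_cycle A :
  colorable_on A 2 \/ exists n c, shortest_odd_cycle (edge_in A) n c.
Proof.
case: (ex_shortest_odd_cycle (@edge_in_sym A)); first by right.
case=> c cP; left; exists (fun x => c x : nat); split=> [x _|x y xA yA xy].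
  by case: (c x).
have /cP : edge_in A x y by rewrite /edge_in xA yA.
by case: (c x); case: (c y).
Qed.

Lemma iocp_on0_colorable A : iocp_on_le A 0 -> colorable_on A 2.
Proof.
move=> le0; case: (colorable2_or_odd_cycle A) => // -[n [c cP]].
have [] // := @iocp_on_lt A set0 _ 0 (shortest_odd_cycle_sub cP) (sub0set _)
  (shortest_odd_cycle_induced cP) _ le0.
by move=> x y _; rewrite inE.
Qed.

(* If x is a neighbour of c i, y a neighbour of c j and x -- y, then the cyclic
   distance of i and j is 1 or 3.  So colour x by the parity of i, with a
   separate colour for each of the last three positions. *)
Lemma cycle_nbhd_colorable5 A n c : shortest_odd_cycle (edge_in A) n c -> 3 < n ->
  colorable_on [set x in A | has (fun v => x -- v) (mkseq c n)] 5.
Proof.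
move=> cP n_gt3; pose pos x := find (fun v => x -- v) (mkseq c n).
have posP x : x \in [set x in A | has (fun v => x -- v) (mkseq c n)] ->
    pos x < n /\ edge_in A x (c (pos x)).
  rewrite inE => /andP[xA hx]; have lt_n : pos x < n.
    by rewrite -(size_mkseq c n) -has_find.
  split=> //; have := nth_find (c 0) hx; rewrite nth_mkseq // /edge_in xA => -> /=.
  case: cP => _ _ /(_ _ lt_n) /and3P[cA _ _] _.
  by rewrite cA.
pose g i : nat := if i < n - 3 then nat_of_bool (odd i) else i - (n - 3) + 2.
exists (fun x => g (pos x)); split=> [x /posP[lt_n _]|x y xN yN xy].
  by rewrite /g; case: ifP; lia.
wlog le_xy : x y xN yN xy / pos x <= pos y.
  move=> wlog_xy; case/orP: (leq_total (pos x) (pos y)) => [|le]; first exact: wlog_xy.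
  by rewrite eq_sym; apply: wlog_xy => //; rewrite sedge_sym.
have [xn ex] := posP _ xN; have [yn ey] := posP _ yN.
have exy : edge_in A x y.
  by move: xN yN; rewrite !inE /edge_in xy => /andP[-> _] /andP[-> _].
have w3 : walk (edge_in A) (1 + (1 + 1)) (c (pos x)) (c (pos y)).
  apply: (walk_cat (walk1 _) (walk_cat (walk1 exy) (walk1 ey))).
  by rewrite edge_in_sym.
have le_xyn : pos x <= pos y < n by rewrite le_xy.
have := shortest_odd_cycle_dist (@edge_in_sym A) cP le_xyn w3.
by have [odd_n _ _ _] := cP; rewrite /g; do 3![case: ifP]; lia.
Qed.

Lemma triangle_free_colorable A k :
  (forall Q, Q \subset A -> clique Q -> #|Q| <= 2) ->
  iocp_on_le A k -> colorable_on A (2 + 5 * k).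
Proof.
elim: k A => [|k IHk] A tfA le_k; first exact: iocp_on0_colorable.
case: (colorable2_or_odd_cycle A) => [|[n [c cP]]].
  by apply: colorable_onW; rewrite //; lia.
have cI := shortest_odd_cycle_induced cP; have cA := shortest_odd_cycle_sub cP.
have [odd_n cn ce _] := cP.
(* For odd [n], the case [n = 1] would be a loop and [n = 3] a triangle. *)
have n_gt3 : 3 < n.
  rewrite ltnNge; apply/negP=> n_le3.
  have n3 : n = 3.
    case: n cP odd_n cn ce n_le3 {cI cA} => [|[|[|[|n]]]] // _ _ cn /(_ 0 isT).
    by rewrite cn /edge_in sedge_irr !andbF.
  subst n; have sz : 2 < #|[set x in mkseq c 3]| by case/and3P: cI.
  have: clique [set x in mkseq c 3].
    have /and3P[_ _ e01] := ce 0 isT; have /and3P[_ _ e12] := ce 1 isT.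
    have /and3P[_ _ ] := ce 2 isT; rewrite cn => e20.
    apply/forall_inP=> x; rewrite !inE => x3; apply/forall_inP=> y; rewrite !inE => y3.
    apply/implyP; case/or3P: x3 => /eqP->; case/or3P: y3 => /eqP->;
      by rewrite ?eqxx // 1?sedge_sym.
  by move/(tfA _ cA); rewrite leqNgt sz.
(* Every vertex of the cycle has a neighbour on it, so [N] contains the cycle and [A :\: N] is both
   disjoint from it and anticomplete to it. *)
set N := [set x in A | has (fun v => x -- v) (mkseq c n)].
apply: (@colorable_onW _ (N :|: (A :\: N)) (5 + (2 + 5 * k))); last 1 first.
- apply: colorable_onU; first exact: cycle_nbhd_colorable5.
  apply: IHk => [Q sQ|]; first by apply: tfA; apply: subset_trans sQ (subsetDl _ _).
  have [] // := iocp_on_lt cA (subsetDl A N) cI _ le_k.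
  move=> x y xC; rewrite !inE negb_and => /andP[yN yA].
  rewrite yA /= in yN; have xc : x \in mkseq c n by rewrite inE in xC.
  split; last by rewrite sedge_sym; apply: (hasPn yN).
  by apply: contraNneq yN => <-; apply: cycle_has_nbr cP xc.
- by apply/subsetP=> x xA; rewrite !inE xA andbT orbN.
- lia.
Qed.

(** * Sorting vertices by their non-neighbours in a maximum clique *)

Lemma triangle_induces_odd_cycle T : clique T -> #|T| = 3 -> induces_odd_cycle T.
Proof.
move=> cliqueT T3.
have [x xT] : exists x, x \in T by apply/set0Pn; rewrite -card_gt0 T3.
have /cards2P[y [z [yz Tyz]]] : #|T :\ x| == 2.
  by have := cardsD1 x T; rewrite xT T3 add1n => -[<-].
have := in_set2 y y z; have := in_set2 z y z; rewrite -Tyz !inE !eqxx orbT /=.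
move=> /andP[zx zT] /andP[yx yT].
have adj u v : u \in T -> v \in T -> u != v -> u -- v.
  by move=> uT vT; move/forall_inP/(_ u uT)/forall_inP/(_ v vT)/implyP: cliqueT; apply.
(* Reducing the index modulo 3 makes the listing close up: its value at 3 is its value at 0. *)
have -> : T = [set v in mkseq (fun i => nth x [:: x; y; z] (i %% 3)) 3].
  apply/setP=> v; rewrite !inE -in_set2 -Tyz !inE.
  by case: eqVneq => [->|].
apply: induces_odd_cycle_fun => // i j.
- by case: i => [|[|[|i]]]; case: j => [|[|[|j]]]; rewrite ?andbF //= => _;
  rewrite // eq_sym.
- by case: i => [|[|[|i]]]; case: j => [|[|[|j]]]; rewrite ?andbF //= => _;
  rewrite adj // eq_sym.
Qed.

Definition nonnbrs K (x : G) := [set v in K | ~~ (v -- x)].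

(* Otherwise replacing D by Q in K would give a clique larger than K. *)
Lemma clique_same_nonnbrs A K Q D :
  clique K -> K \subset A ->
  (forall R : {set G}, R \subset A -> clique R -> #|R| <= #|K|) ->
  Q \subset A -> clique Q -> {in Q, forall x, nonnbrs K x = D} -> #|Q| <= #|D|.
Proof.
move=> cK sKA maxK sQA cQ QD.
have [->|[x0 x0Q]] := set_0Vmem Q; first by rewrite cards0.
have sDK : D \subset K.
  by rewrite -(QD _ x0Q); apply/subsetP=> v; rewrite inE => /andP[].
have adj v x : v \in K :\: D -> x \in Q -> v -- x.
  by rewrite inE => /andP[vD vK] xQ; move: vD; rewrite -(QD _ xQ) inE vK negbK.
have dis : [disjoint K :\: D & Q].
  apply/pred0P=> v /=; apply/negP=> /andP[vK vQ].
  by have := adj v v vK vQ; rewrite sedge_irr.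
have : #|(K :\: D) :|: Q| <= #|K|.
  apply: maxK.
    by rewrite subUset sQA andbT; apply: subset_trans (subsetDl _ _) sKA.
  apply/forall_inP=> x; rewrite in_setU => x_in; apply/forall_inP=> y.
  rewrite in_setU => y_in; apply/implyP=> xy.
  case/orP: x_in => [xK|xQ]; case/orP: y_in => [yK|yQ].
  - move: xK yK; rewrite !inE => /andP[_ xK] /andP[_ yK].
    by move/forall_inP/(_ x xK)/forall_inP/(_ y yK)/implyP: cK; apply.
  - exact: adj.
  - by rewrite sedge_sym; apply: adj.
  - by move/forall_inP/(_ x xQ)/forall_inP/(_ y yQ)/implyP: cQ; apply.
have := leq_card_setU (K :\: D) Q; rewrite dis => /leqifP/eqP->.
rewrite cardsD (setIidPr sDK); have := subset_leq_card sDK; lia.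
Qed.

(** The induction on [k] passes to subsets of [A]. Taking [w] as an upper bound on clique sizes, not
    the exact clique number, lets the same [w] serve for all of them. *)
Lemma colorable_chi_bound A k w :
  (forall Q, Q \subset A -> clique Q -> #|Q| <= w) ->
  iocp_on_le A k -> colorable_on A (chi_bound k w).
Proof.
elim: k A => [|k IHk] A le_w le_k; first exact: iocp_on0_colorable.
have clique0 : (set0 \subset A) && clique (set0 : {set G}).
  by rewrite sub0set; apply/forall_inP=> x; rewrite inE.
case: (@arg_maxnP _ set0 (fun Q : {set G} => (Q \subset A) && clique Q)
  (fun Q => #|Q|) clique0) => K /andP[sKA cK] maxK'.
have maxK Q : Q \subset A -> clique Q -> #|Q| <= #|K|.
  by move=> sQ cQ; apply: maxK'; rewrite sQ.
have same := @clique_same_nonnbrs A K _ _ cK sKA maxK.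
pose draws j := [set D : {set G} | (D \subset K) && (#|D| == j)].
have card_draws j : #|draws j| <= 'C(w, j).
  by rewrite cards_draws; apply/leq_bin2l/le_w.
have sNK x : nonnbrs K x \subset K by apply/subsetP=> v; rewrite inE => /andP[].
pose S D := [set x in A | nonnbrs K x == D].
have sSA D : S D \subset A by apply/subsetP=> x; rewrite inE => /andP[].
have cliqueS D Q : Q \subset S D -> clique Q -> #|Q| <= #|D|.
  move=> /subsetP sQ cQ; apply: same cQ _ => [|x /sQ].
    by apply/subsetP=> x /sQ; apply: (subsetP (sSA D)).
  by rewrite inE => /andP[_ /eqP].
pose A_ j := [set x in A | #|nonnbrs K x| == j].
have coverA j : {in A_ j, forall x, exists2 D, D \in draws j & x \in S D}.
  by move=> x; rewrite inE => /andP[xA cx]; exists (nonnbrs K x);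
    rewrite inE ?sNK ?xA ?eqxx.
have col1 : colorable_on (A_ 1) (1 * 'C(w, 1)).
  apply: (@colorable_onW _ (A_ 1) (1 * #|draws 1|)); rewrite // ?leq_mul //.
  apply: colorable_on_cover (coverA 1) => D; rewrite inE => /andP[_ /eqP D1].
  exists (fun=> 0); split=> // x y xS yS xy.
  have: #|[set x; y]| <= #|D|.
    apply: cliqueS; first by rewrite subUset !sub1set xS.
    apply/forall_inP=> u /set2P u_in; apply/forall_inP=> v /set2P v_in.
    apply/implyP; case: u_in v_in => [->|->] [->|->]; rewrite ?eqxx //.
    by rewrite sedge_sym.
  rewrite D1 cards2; case: eqVneq xy => // ->; by rewrite sedge_irr.
have col2 : colorable_on (A_ 2) ((2 + 5 * k.+1) * 'C(w, 2)).
  apply: (@colorable_onW _ (A_ 2) ((2 + 5 * k.+1) * #|draws 2|));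
    rewrite // ?leq_mul //.
  apply: colorable_on_cover (coverA 2) => D; rewrite inE => /andP[_ /eqP D2].
  apply: triangle_free_colorable; last exact: iocp_on_leS (sSA D) le_k.
  by move=> Q sQ cQ; rewrite -D2; apply: cliqueS.
pose A3 := [set x in A | 2 < #|nonnbrs K x|].
have col3 : colorable_on A3 (chi_bound k w * 'C(w, 3)).
  apply: (@colorable_onW _ A3 (chi_bound k w * #|draws 3|)); rewrite // ?leq_mul //.
  (* Grouping by a triangle [T] of non-neighbours instead of the whole set [nonnbrs K x] keeps the
     number of groups at most ['C(w, 3)]; a vertex may lie in several groups. *)
  pose B T := [set x in A | T \subset nonnbrs K x].
  apply: (@colorable_on_cover A3 (draws 3) B) => [T|x]; last first.
    rewrite inE => /andP[xA /card_geqP[s [Us s3 sub_s]]].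
    have sT : [set v in s] \subset nonnbrs K x.
      by apply/subsetP=> v; rewrite inE; apply: sub_s.
    exists [set v in s]; rewrite inE ?xA // (subset_trans sT (sNK x)).
    by rewrite cardsE (card_uniqP Us) s3.
  rewrite inE => /andP[sTK /eqP T3].
  have sBA : B T \subset A by apply/subsetP=> x; rewrite inE => /andP[].
  apply: IHk => [Q sQ|]; first by apply: le_w; apply: subset_trans sBA.
  have cT : clique T.
    apply/forall_inP=> x /(subsetP sTK) xK; apply/forall_inP=> y /(subsetP sTK).
    by move/forall_inP/(_ x xK)/forall_inP: cK; apply.
  have [] // := iocp_on_lt (subset_trans sTK sKA) sBA
    (triangle_induces_odd_cycle cT T3) _ le_k.
  move=> x y xT; rewrite inE => /andP[_ sTy]; split; last first.
    by have := subsetP sTy x xT; rewrite inE => /andP[].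
  (* If [y] were in [T], all of the clique [T] would be non-adjacent to [y], leaving only [y] itself
     in [T]. *)
  apply: contraTneq xT => ->; apply/negP=> yT.
  have : T \subset [set y].
    apply/subsetP=> v vT; have := subsetP sTy v vT; rewrite !inE => /andP[_].
    apply: contraR => vy; move/forall_inP/(_ v vT)/forall_inP/(_ y yT): cT.
    by rewrite vy.
  by move/subset_leq_card; rewrite cards1 T3.
apply: (@colorable_onW _ (A_ 1 :|: A_ 2 :|: A3)
  (1 * 'C(w, 1) + (2 + 5 * k.+1) * 'C(w, 2) + chi_bound k w * 'C(w, 3))).
- apply/subsetP=> x xA; rewrite !inE xA /=.
  (* The exchange argument for the one-vertex clique shows that each vertex has a non-neighbour in
     [K], so the three classes cover [A]. *)
  have : #|[set x]| <= #|nonnbrs K x|.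
    apply: same; first by rewrite sub1set.
      by apply/forall_inP=> u /set1P->; apply/forall_inP=> v /set1P->; rewrite eqxx.
    by move=> u /set1P->.
  by rewrite cards1; lia.
- by rewrite /= bin1 mul1n.
- by do 2?[apply: colorable_onU].
Qed.

End Coloring.

Theorem theorem7 (G : sgraph) (G_nonempty : 0 < #|G|) :
  chi G <= chi_bound (iocp G) (omega G).
Proof.
apply/colorable_onT/colorable_chi_bound => [Q _ cQ|P packP _].
  exact: (leq_bigmax_cond (F := fun Q : {set G} => #|Q|)).
exact: (leq_bigmax_cond (F := fun P : {set {set G}} => #|P|)).
Qed.
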